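(* Let $K$ be a global function field of characteristic $p$ with constant field $\mathbb{F}_q$, let $v$ be a normalized nontrivial valuation on $K$, let $K_v$ be the completion of $K$ at $v$ and $A_v$ its valuation ring. Let $\pi\in K_v$ with $v(\pi)$ a positive integer, and let $\Gamma\subset A_v$ be a complete set of representatives of $A_v/\pi A_v$. Then $(\Gamma,\pi)$ has property A if and only if the following two conditions hold: (i) $\pi$ and all elements of $\Gamma$ are rational, i.e. $\pi\in K$ and $\Gamma\subset K$; (ii) $[K:\mathbb{F}_q(\pi)]=[K_v:\mathbb{F}_q((\pi))]$.
   Context: A global function field of characteristic $p$ is a field $K\supset\mathbb{F}_p$ containing an element $x$ transcendental over $\mathbb{F}_p$ with $[K:\mathbb{F}_p(x)]<\infty$; its constant field is the algebraic closure of $\mathbb{F}_p$ in $K$. A valuation on $K$ is a map $v:K^*\to\mathbb{Z}$ with $v(ab)=v(a)+v(b)$ and $v(a+b)\ge\min\{v(a),v(b)\}$, with $v(0)=+\infty$; it is normalized if $v(K^* )=\mathbb{Z}$. The valuation extends to the completion $K_v$, with valuation ring $A_v$. $\mathbb{F}_q(\pi)$ is the field generated by $\pi$ over $\mathbb{F}_q$, and $\mathbb{F}_q((\pi))$ is the completion (closure) of $\mathbb{F}_q(\pi)$ in $K_v$. Condition (ii) is considered together with (i), so that $\mathbb{F}_q(\pi)\subset K$. A complete set of representatives of $A_v/\pi A_v$ is a subset $\Gamma\subset A_v$ containing exactly one element of each residue class modulo $\pi A_v$ (it is finite). An expansion of $x\in K_v$ with respect to $(\Gamma,\pi)$ is a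 representation $x=\sum_{n\ge m}a_n\pi^n$ with $m\in\mathbb{Z}$ and $a_n\in\Gamma$ for all $n\ge m$; for each $m$ with $x\in\pi^mA_v$ there is exactly one such expansion starting at $m$. Its sequence of coefficients is $\{a_n\}_{n\ge m}$. A sequence $\{a_n\}_{n\ge m}$ is ultimately periodic if there are integers $N\ge m$ and $L>0$ with $a_{n+L}=a_n$ for all $n\ge N$. $(\Gamma,\pi)$ has property A if for every $x\in K_v$ and every expansion $x=\sum_{n\ge m}a_n\pi^n$ with respect to $(\Gamma,\pi)$: $x\in K$ if and only if $\{a_n\}_{n\ge m}$ is ultimately periodic. *)

(* Defs.v *)
From mathcomp Require Import all_boot all_order all_algebra.
From mathcomp Require Import boolp classical_sets functions cardinality.

Set Implicit Arguments.
Unset Strict Implicit.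
Unset Printing Implicit Defensive.

Import Order.TTheory GRing.Theory Num.Theory.

Local Open Scope classical_set_scope.
Local Open Scope ring_scope.

Section Degree.
Variable L : fieldType.

Definition is_subfield (E : set L) : Prop := divring_closed (mem E).

Definition subfield_gen (S : set L) : set L := smallest is_subfield S.

Definition is_basis (E : set L) (d : nat) (b : 'I_d -> L) : Prop :=
  (forall c : 'I_d -> L, (forall i, E (c i)) ->
     \sum_i c i * b i = 0 -> forall i, c i = 0) /\
  (forall x : L, exists2 c : 'I_d -> L,
     forall i, E (c i) & x = \sum_i c i * b i).

Definition has_degree (E : set L) (d : nat) : Prop :=
  exists b : 'I_d -> L, is_basis E b.

(* [L : E], with None for an infinite degree. For a subfield E the size of a
   finite basis is unique, so the choice made by cid is immaterial. *)
Definition degree (E : set L) : option nat :=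
  if pselect (exists d, has_degree E d) is left h then Some (projT1 (cid h))
  else None.

End Degree.

(* The inclusion of F_p in K is given by a morphism iFp; a proof that p is
   prime is needed for 'F_p to be the field with p elements. *)
Section FunctionField.
Variables (p : nat) (K : fieldType) (iFp : {rmorphism 'F_p -> K}).

Definition is_global_function_field : Prop :=
  prime p /\
  exists x : K, ~ algebraicOver iFp x /\
    exists d, has_degree (subfield_gen (range iFp `|` [set x])) d.

Definition constant_field : set K := [set a | algebraicOver iFp a].

End FunctionField.

Section Valuation.
Variable F : fieldType.

(* The value of v : F -> int at 0 is meaningless: v is only used on F^*, and
   v 0 = +oo is rendered by val_ge below. *)
Definition is_valuation (v : F -> int) : Prop :=
  (forall a b, a != 0 -> b != 0 -> v (a * b) = v a + v b) /\
  (forall a b, a != 0 -> b != 0 -> a + b != 0 ->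
     Num.min (v a) (v b) <= v (a + b)).

Definition nontrivial_valuation (v : F -> int) : Prop :=
  exists2 a, a != 0 & v a != 0.

Definition normalized (v : F -> int) : Prop :=
  forall n : int, exists2 a, a != 0 & v a = n.

Definition val_ge (v : F -> int) (n : int) (x : F) : Prop :=
  x = 0 \/ n <= v x.

Definition val_ring (v : F -> int) : set F := [set x | val_ge v 0 x].

Definition val_cvg (v : F -> int) (u : nat -> F) (l : F) : Prop :=
  forall M : int, exists N : nat, forall n : nat, (N <= n)%N ->
    val_ge v M (u n - l).

Definition val_cauchy (v : F -> int) (u : nat -> F) : Prop :=
  forall M : int, exists N : nat, forall i j : nat, (N <= i)%N -> (N <= j)%N ->
    val_ge v M (u i - u j).

Definition val_complete (v : F -> int) : Prop :=
  forall u, val_cauchy v u -> exists l, val_cvg v u l.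

Definition val_closure (v : F -> int) (S : set F) : set F :=
  [set x | forall M : int, exists2 s, S s & val_ge v M (s - x)].

End Valuation.

Definition is_completion (K Kv : fieldType) (v : K -> int)
    (iota : {rmorphism K -> Kv}) (w : Kv -> int) : Prop :=
  [/\ is_valuation w,
      forall x, x != 0 -> w (iota x) = v x,
      val_closure w (range iota) = setT
    & val_complete w].

Section Expansions.
Variables (Kv : fieldType) (w : Kv -> int).

Definition complete_representatives (Gamma : set Kv) (pi : Kv) : Prop :=
  Gamma `<=` val_ring w /\
  forall y, val_ring w y ->
    exists! g, Gamma g /\ ((fun z => pi * z) @` val_ring w) (y - g).

(* x = \sum_(n >= m) a n * pi ^ n; the values of a below m are irrelevant. *)
Definition is_expansion (Gamma : set Kv) (pi x : Kv) (m : int)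
    (a : int -> Kv) : Prop :=
  (forall n : int, m <= n -> Gamma (a n)) /\
  val_cvg w (fun N => \sum_(k < N) a (m + k%:Z) * pi ^ (m + k%:Z)) x.

Definition ultimately_periodic (m : int) (a : int -> Kv) : Prop :=
  exists N L : int, [/\ m <= N, 0 < L & forall n, N <= n -> a (n + L) = a n].

Definition property_A (K : fieldType) (iota : {rmorphism K -> Kv})
    (Gamma : set Kv) (pi : Kv) : Prop :=
  forall x m a, is_expansion Gamma pi x m a ->
    (range iota x <-> ultimately_periodic m a).

End Expansions.

(* Main.v *)
(* Write O for the valuation ring of v on K, E = F_q(pi), and let b_1, ..., b_d in O
   lift an F_q-basis of O/pi.  The residue ring O/pi is finite: s pairwise
   incongruent elements of O give s^a distinct sums with a digits in base pi, while
   counting polynomial coordinates over F_p(x) bounds their number by C Q^a.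
   Reduction modulo pi shows that b is independent over the closure of E, and
   successive approximation shows that b spans K_v over it, so that this closure has
   degree d in K_v.  Condition (ii) therefore says that b is a basis of K over E.

   The expansion of x in K_v is obtained by iterating the shift
   y |-> (y - digit y) / pi on A_v, and it is ultimately periodic iff two iterates
   agree.

   If b is a basis of K over E, the iterates of x in O can be written with a common
   denominator and numerators of bounded degree in F_q[pi], hence they repeat;
   conversely periodic expansions with rational pi and digits sum to elements of K.

   If property A holds, the constant expansions g pi^m / (1 - pi) show that pi and
   Gamma are rational; since elements of O have periodic expansions, O is generated
   by the finite set Gamma over the local ring of E, and Nakayama's lemma replaces
   Gamma by b. *)
Require Import Defs.
From HB Require Import structures.
From mathcomp Require Import all_boot all_order all_algebra.
From mathcomp Require Import boolp classical_sets functions cardinality.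
From mathcomp Require Import zify ring.

Set Implicit Arguments.
Unset Strict Implicit.
Unset Printing Implicit Defensive.

Import Order.TTheory GRing.Theory Num.Theory.

Local Open Scope classical_set_scope.
Local Open Scope ring_scope.

(** * Degrees over subfields *)

Section SubfieldType.
Variables (L : fieldType) (E : set L) (hE : is_subfield E).

(** Indexed by the proof of closure so that instance inference can recover that proof from the
    predicate. *)
Definition subfield_pred of is_subfield E : {pred L} := mem E.

HB.instance Definition _ := GRing.isDivringClosed.Build L (subfield_pred hE) hE.

Record subfield_type :=
  SubfieldType {subfield_val :> L; _ : subfield_val \in subfield_pred hE}.

HB.instance Definition _ := [isSub for subfield_val].
HB.instance Definition _ := [Choice of subfield_type by <:].
HB.instance Definition _ := [SubChoice_isSubIntegralDomain of subfield_type by <:].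
HB.instance Definition _ := [SubIntegralDomain_isSubField of subfield_type by <:].

(** Turns a subset into the image of a field type, which makes matrices and polynomials over it
    available. *)
Lemma subfieldP : exists (F : fieldType) (phi : {rmorphism F -> L}), E = range phi.
Proof.
exists subfield_type, (\val : {rmorphism subfield_type -> L}).
rewrite eqEsubset; split=> [x Ex|_ [y _ <-]]; last by case: y => x /= /set_mem.
have Ex' : x \in subfield_pred hE by apply: mem_set.
by exists (SubfieldType Ex').
Qed.

End SubfieldType.

Lemma range_choice (I T U : Type) (f : T -> U) (c : I -> U) :
  (forall i, range f (c i)) -> exists a : I -> T, forall i, c i = f (a i).
Proof.
move=> fc; have h i : exists x, c i = f x by have [x _ <-] := fc i; exists x.
by have [a] := choice h; exists a.
Qed.

Section Degree.
Variable L : fieldType.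
Implicit Type E : set L.

Lemma range_subfield (F : fieldType) (phi : {rmorphism F -> L}) :
  is_subfield (range phi).
Proof.
split; first by apply/mem_set; exists 1; rewrite ?rmorph1.
- move=> _ _ /set_mem[x _ <-] /set_mem[y _ <-].
  by apply/mem_set; exists (x - y); rewrite ?rmorphB.
- move=> _ _ /set_mem[x _ <-] /set_mem[y _ <-].
  by apply/mem_set; exists (x / y); rewrite ?fmorph_div.
Qed.

(** The coordinate matrix has more rows than columns, so its left kernel contains a nonzero vector,
    whose entries are the coefficients sought. *)
Lemma dependence_over_subfield E d (b : 'I_d -> L) n (y : 'I_n -> L) :
  is_subfield E ->
  (forall x, exists2 c : 'I_d -> L, forall i, E (c i) & x = \sum_i c i * b i) ->
  (d < n)%N ->
  exists c : 'I_n -> L, [/\ forall i, E (c i), \sum_i c i * y i = 0 &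
    exists i, c i != 0].
Proof.
move=> /subfieldP[F [phi ->]] spanb ltdn.
have /choice[a yE] : forall i, exists a : 'I_d -> F, y i = \sum_j phi (a j) * b j.
  move=> i; have [c /range_choice[a ca] ->] := spanb (y i).
  by exists a; under eq_bigr do rewrite ca.
pose A : 'M[F]_(n, d) := \matrix_(i, j) a i j.
have /rowV0Pn[u /sub_kermxP uA u0] : kermx A != 0.
  by rewrite -mxrank_eq0 mxrank_ker subn_eq0 -ltnNge (leq_ltn_trans (rank_leq_col A)).
exists (fun i => phi (u 0 i)); split=> [i|  |]; first by exists (u 0 i).
- transitivity (\sum_j phi ((u *m A) 0 j) * b j).
    under eq_bigr do rewrite yE mulr_sumr.
    rewrite exchange_big; apply: eq_bigr => j _ /=.
    rewrite mxE rmorph_sum mulr_suml; apply: eq_bigr => i _.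
    by rewrite !mxE rmorphM mulrA.
  by rewrite uA big1 // => j _; rewrite mxE rmorph0 mul0r.
- by have /rV0Pn[i ui] := u0; exists i; rewrite fmorph_eq0.
Qed.

Lemma independent_size E d (b : 'I_d -> L) n (y : 'I_n -> L) :
  is_subfield E ->
  (forall x, exists2 c : 'I_d -> L, forall i, E (c i) & x = \sum_i c i * b i) ->
  (forall c : 'I_n -> L, (forall i, E (c i)) ->
     \sum_i c i * y i = 0 -> forall i, c i = 0) ->
  (n <= d)%N.
Proof.
move=> hE spanb indy; rewrite leqNgt; apply/negP => ltdn.
have [c [Ec c0 [i]]] := dependence_over_subfield y hE spanb ltdn.
by rewrite indy ?eqxx.
Qed.

Lemma degreeP E d : is_subfield E -> degree E = Some d <-> has_degree E d.
Proof.
move=> hE; rewrite /degree; case: pselect => [h|nh]; last first.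
  by split=> // hd; case: nh; exists d.
case: cid => e /= [b [indb spanb]]; split=> [[<-]|[c [indc spanc]]]; first by exists b.
congr Some; apply/eqP.
by rewrite eqn_leq (independent_size hE spanb indc) (independent_size hE spanc indb).
Qed.

(** Adjoining [x] to [b] gives [d.+1] vectors, hence a relation; independence of [b] forces the
    coefficient of [x] to be nonzero, so [x] can be solved for. *)
Lemma independent_is_basis E d (b : 'I_d -> L) :
  is_subfield E -> has_degree E d ->
  (forall c : 'I_d -> L, (forall i, E (c i)) ->
     \sum_i c i * b i = 0 -> forall i, c i = 0) ->
  is_basis E b.
Proof.
move=> hE [y [indy spany]] indb; split=> // x.
pose z (i : 'I_d.+1) := if unlift ord0 i is Some j then b j else x.
have [c [Ec]] := dependence_over_subfield z hE spany (ltnSn d).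
rewrite big_ord_recl {1}/z unlift_none.
under eq_bigr do rewrite /z liftK.
have [F [phi EE]] := subfieldP hE; rewrite EE in Ec indb *.
have [c0|c0] := eqVneq (c ord0) 0.
  rewrite c0 mul0r add0r => /indb ind [i].
  case: (unliftP ord0 i) => [j|] ->; last by rewrite c0 eqxx.
  by rewrite ind ?eqxx.
move=> /eqP; rewrite addr_eq0 => /eqP rel _.
exists (fun i => - c (lift ord0 i) / c ord0) => [i|].
  have [u _ <-] := Ec (lift ord0 i); have [w _ <-] := Ec ord0.
  by exists (- u / w); rewrite ?fmorph_div ?rmorphN.
apply: (mulfI c0); rewrite rel mulr_sumr -sumrN; apply: eq_bigr => i _.
by rewrite mulrA [c ord0 * _]mulrC divfK ?mulNr.
Qed.

End Degree.

(** * Fractions and valuations *)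

Section SubfieldClosed.
Variables (L : fieldType) (E : set L) (hE : is_subfield E).

Lemma subfield1 : E 1.
Proof. by case: hE => /set_mem. Qed.

Lemma subfieldB x y : E x -> E y -> E (x - y).
Proof. by case: hE => _ h _ Ex Ey; apply/set_mem/h; apply/mem_set. Qed.

Lemma subfield_div x y : E x -> E y -> E (x / y).
Proof. by case: hE => _ _ h Ex Ey; apply/set_mem/h; apply/mem_set. Qed.

Lemma subfield0 : E 0.
Proof. by rewrite -(subrr 1); apply: subfieldB; apply: subfield1. Qed.

Lemma subfieldD x y : E x -> E y -> E (x + y).
Proof.
by move=> Ex Ey; rewrite -[y]opprK -[- y]sub0r; do !apply: subfieldB => //; apply: subfield0.
Qed.

Lemma subfieldM x y : E x -> E y -> E (x * y).
Proof.
by move=> Ex Ey; rewrite -[y]invrK -[y^-1]div1r; do !apply: subfield_div => //; apply: subfield1.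
Qed.

Lemma subfieldX x n : E x -> E (x ^+ n).
Proof.
move=> Ex; elim: n => [|n ih]; first exact: subfield1.
by rewrite exprS; apply: subfieldM.
Qed.

Lemma subfield_sum (I : Type) (r : seq I) (P : pred I) (f : I -> L) :
  (forall i, P i -> E (f i)) -> E (\sum_(i <- r | P i) f i).
Proof. by move=> h; apply: big_ind => //; [exact: subfield0|exact: subfieldD]. Qed.

End SubfieldClosed.

Lemma subfield_gen_subfield (L : fieldType) (S : set L) : is_subfield (subfield_gen S).
Proof.
split; first by apply/mem_set => M [/subfield1].
- move=> x y /set_mem Ex /set_mem Ey; apply/mem_set => M SM.
  by apply: subfieldB; [case: SM|apply: Ex|apply: Ey].
- move=> x y /set_mem Ex /set_mem Ey; apply/mem_set => M SM.
  by apply: subfield_div; [case: SM|apply: Ex|apply: Ey].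
Qed.

(** * Fractions in one generator and combinations of bounded degree *)

Section Fractions.
Variables (F K : fieldType) (phi : {rmorphism F -> K}) (x : K).

Local Notation ev P := (map_poly phi P).[x].
Local Notation E := (subfield_gen (range phi `|` [set x])).

(** These fractions already form a subfield containing the generators, so minimality applies. *)
Lemma subfield_gen_fraction r : E r ->
  exists P Q, ev Q != 0 /\ r = ev P / ev Q.
Proof.
pose R : set K := [set r | exists P Q, ev Q != 0 /\ r = ev P / ev Q].
suff ER : E `<=` R by exact: ER.
apply: smallest_sub => [|_ [[c _ <-]|->]]; last 2 first.
- by exists c%:P, 1; rewrite rmorph1 map_polyC !hornerC oner_neq0 divr1.
- by exists 'X, 1; rewrite rmorph1 map_polyX hornerX hornerC oner_neq0 divr1.
split; first by apply/mem_set; exists 1, 1; rewrite rmorph1 hornerC oner_neq0 divr1.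
- move=> _ _ /set_mem[P1 [Q1 [h1 ->]]] /set_mem[P2 [Q2 [h2 ->]]]; apply/mem_set.
  exists (P1 * Q2 - P2 * Q1), (Q1 * Q2).
  rewrite rmorphB !rmorphM !hornerE mulf_neq0 //; split=> //.
  by rewrite -mulNr addf_div // mulNr.
- move=> _ _ /set_mem[P1 [Q1 [h1 ->]]] /set_mem[P2 [Q2 [h2 ->]]]; apply/mem_set.
  (* The inverse of 0 is 0, so a quotient by zero is the fraction 0 / 1. *)
  have [e0|e0] := eqVneq (ev P2) 0.
    by exists 0, 1; rewrite e0 rmorph1 rmorph0 !hornerC oner_neq0 !mul0r invr0 mulr0.
  exists (P1 * Q2), (Q1 * P2).
  by rewrite !rmorphM !hornerE mulf_neq0 //; split=> //; rewrite invf_div mulf_div.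
Qed.

Section BoundedCombinations.
Variables (n : nat) (b : 'I_n -> K).

Definition bounded_comb (h : nat) : set K :=
  [set y | exists P : 'I_n -> {poly F},
     (forall i, (size (P i) <= h)%N) /\ y = \sum_i ev (P i) * b i].

Lemma bounded_combW h h' y : (h <= h')%N -> bounded_comb h y -> bounded_comb h' y.
Proof. by move=> hh [P [sP ->]]; exists P; split=> // i; apply: leq_trans (sP i) hh. Qed.

Lemma bounded_combD h y z : bounded_comb h y -> bounded_comb h z -> bounded_comb h (y + z).
Proof.
move=> [P [sP ->]] [Q [sQ ->]]; exists (fun i => P i + Q i); split=> [i|].
  by apply: leq_trans (size_polyD _ _) _; rewrite geq_max sP sQ.
by rewrite -big_split; apply: eq_bigr => i _ /=; rewrite rmorphD hornerD mulrDl.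
Qed.

Lemma bounded_comb0 h : bounded_comb h 0.
Proof.
exists (fun => 0); split=> [i|]; first by rewrite size_poly0.
by rewrite big1 // => i _; rewrite rmorph0 horner0 mul0r.
Qed.

Lemma bounded_combM h h' (Q : {poly F}) y : (size Q <= h')%N ->
  bounded_comb h y -> bounded_comb (h + h') (ev Q * y).
Proof.
move=> sQ [P [sP ->]]; exists (fun i => Q * P i); split=> [i|].
  apply: leq_trans (size_polyMleq _ _) _.
  by rewrite (leq_trans (leq_pred _)) // addnC leq_add.
by rewrite mulr_sumr; apply: eq_bigr => i _; rewrite rmorphM hornerM mulrA.
Qed.

(** Multiplication by [t] may create denominators; [Q] clears them for all [t * b i] at once, at a
    fixed cost [h'] in degree. *)
Lemma bounded_combMt h h' t (Q : {poly F}) y :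
  (forall i, bounded_comb h' (ev Q * (t * b i))) ->
  bounded_comb h y -> bounded_comb (h + h') (ev Q * t * y).
Proof.
move=> Qtb [P [sP ->]]; rewrite mulr_sumr.
apply: big_ind => [||i _]; [exact: bounded_comb0|exact: bounded_combD|].
by rewrite mulrCA -(mulrA (ev Q)) addnC; apply: bounded_combM.
Qed.

(** An element is coded by the positions in [s] of its [n * h] coefficients, which leaves at most
    [size s ^ (n * h)] elements. *)
Lemma bounded_comb_finite h (s : seq K) : range phi `<=` [set` s] ->
  exists f : {ffun 'I_n * 'I_h -> 'I_(size s)} -> K, bounded_comb h `<=` range f.
Proof.
move=> sP; exists (fun c : {ffun 'I_n * 'I_h -> 'I_(size s)} =>
  \sum_i (\sum_(j < h) s`_(c (i, j)) * x ^+ j) * b i).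
move=> _ [P [sP' ->]].
have cs i j : (index (phi (P i)`_j)%R s < size s)%N.
  by rewrite index_mem; apply: sP; exists (P i)`_j.
exists [ffun u : 'I_n * 'I_h => Ordinal (cs u.1 u.2)] => //.
apply: eq_bigr => i _; congr (_ * _).
rewrite (@horner_coef_wide _ h); last by rewrite size_map_poly.
by apply: eq_bigr => j _; rewrite ffunE /= nth_index ?coef_map // -index_mem.
Qed.

Hypothesis spanb : forall z, exists2 c : 'I_n -> K, forall i, E (c i) & z = \sum_i c i * b i.

Lemma common_denominator1 z : exists Q h, ev Q != 0 /\ bounded_comb h (ev Q * z).
Proof.
have [c Ec ->] := spanb z.
have [P cP] := choice (fun i => subfield_gen_fraction (Ec i)).
have [Q cPQ] := choice cP.
exists (\prod_i Q i), (\max_i size (P i * \prod_(j | j != i) Q j)%R).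
split; first by rewrite rmorph_prod horner_prod prodf_seq_neq0; apply/allP => i _; case: (cPQ i).
exists (fun i => P i * \prod_(j | j != i) Q j); split=> [i|].
  exact: (leq_bigmax i).
rewrite mulr_sumr; apply: eq_bigr => i _; rewrite (bigD1 i) //= mulrA; congr (_ * _).
by case: (cPQ i) => q0 ->; rewrite !rmorphM !hornerM mulrAC mulrCA divff // mulr1.
Qed.

Lemma common_denominator (s : seq K) :
  exists Q h, ev Q != 0 /\ forall z, z \in s -> bounded_comb h (ev Q * z).
Proof.
elim: s => [|z s [Q [h [Q0 ih]]]]; first by exists 1, 0%N; rewrite rmorph1 hornerC oner_neq0.
have [Q' [h' [Q'0 h'z]]] := common_denominator1 z.
exists (Q * Q'), (maxn (h + size Q') (h' + size Q)).
rewrite rmorphM hornerM mulf_neq0 //; split=> // y; rewrite inE => /predU1P[->|/ih hy].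
  by rewrite -mulrA; apply: bounded_combW (bounded_combM (leqnn _) h'z); rewrite leq_maxr.
by rewrite mulrAC mulrC; apply: bounded_combW (bounded_combM (leqnn _) hy); rewrite leq_maxl.
Qed.

End BoundedCombinations.
End Fractions.

(** * Ultrametric arithmetic with value +oo at 0 *)

Section Valuations.
Variables (K : fieldType) (v : K -> int) (hv : is_valuation v).

Lemma valuationM a b : a != 0 -> b != 0 -> v (a * b) = v a + v b.
Proof. by case: hv => h _; apply: h. Qed.

Lemma valuation1 : v 1 = 0.
Proof.
have := valuationM (oner_neq0 K) (oner_neq0 K); rewrite mulr1 => /eqP.
by rewrite -subr_eq subrr eq_sym => /eqP.
Qed.

Lemma valuationV a : a != 0 -> v a^-1 = - v a.
Proof.
by move=> a0; apply/eqP; rewrite -addr_eq0 -valuationM ?invr_eq0 // mulVf ?valuation1.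
Qed.

Lemma valuationX a n : a != 0 -> v (a ^+ n) = v a *+ n.
Proof.
move=> a0; elim: n => [|n ih]; first by rewrite valuation1.
by rewrite exprS valuationM ?expf_neq0 // ih mulrS.
Qed.

Lemma valuationN a : v (- a) = v a.
Proof.
have [->|a0] := eqVneq a 0; first by rewrite oppr0.
have vN1 : v (-1) = 0.
  have := valuationX 2 (_ : (-1 : K) != 0); rewrite sqrrN expr1n valuation1 oppr_eq0 oner_neq0.
  by move=> /(_ isT)/esym/eqP; rewrite mulrn_eq0 => /eqP.
by rewrite -mulN1r valuationM ?oppr_eq0 ?oner_neq0 // vN1 add0r.
Qed.

Lemma val_ge_neq0 n a : a != 0 -> val_ge v n a <-> n <= v a.
Proof. by move=> a0; split=> [[/eqP|//]|]; [rewrite (negPf a0)|right]. Qed.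

Lemma val_ge0 n : val_ge v n 0.
Proof. by left. Qed.

Lemma val_geW m n a : m <= n -> val_ge v n a -> val_ge v m a.
Proof. by move=> mn [->|na]; [left|right; apply: le_trans na]. Qed.

Lemma val_geN n a : val_ge v n a -> val_ge v n (- a).
Proof. by move=> [->|na]; [rewrite oppr0; left|right; rewrite valuationN]. Qed.

Lemma val_geD n a b : val_ge v n a -> val_ge v n b -> val_ge v n (a + b).
Proof.
have [->|a0] := eqVneq a 0; first by rewrite add0r.
have [->|b0] := eqVneq b 0; first by rewrite addr0.
have [->|ab0] := eqVneq (a + b) 0; first by left.
rewrite !val_ge_neq0 // => na nb; case: hv => _ h.
by apply: le_trans (h _ _ a0 b0 ab0); rewrite le_min na nb.
Qed.

Lemma val_geB n a b : val_ge v n a -> val_ge v n b -> val_ge v n (a - b).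
Proof. by move=> na nb; apply: val_geD => //; apply: val_geN. Qed.

Lemma val_ge_sum n (I : Type) (r : seq I) (P : pred I) (f : I -> K) :
  (forall i, P i -> val_ge v n (f i)) -> val_ge v n (\sum_(i <- r | P i) f i).
Proof. by move=> h; apply: big_ind => //; [exact: val_ge0|move=> *; exact: val_geD]. Qed.

Lemma val_geM m n a b : val_ge v m a -> val_ge v n b -> val_ge v (m + n) (a * b).
Proof.
have [->|a0] := eqVneq a 0; first by rewrite mul0r; left.
have [->|b0] := eqVneq b 0; first by rewrite mulr0; left.
by rewrite !val_ge_neq0 ?mulf_neq0 // valuationM //; apply: lerD.
Qed.

Lemma val_geM0l n a b : val_ge v 0 a -> val_ge v n b -> val_ge v n (a * b).
Proof. by rewrite -{2}[n]add0r; apply: val_geM. Qed.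

Lemma val_geM0r n a b : val_ge v n a -> val_ge v 0 b -> val_ge v n (a * b).
Proof. by rewrite -{2}[n]addr0; apply: val_geM. Qed.

Lemma val_ge1 : val_ge v 0 1.
Proof. by right; rewrite valuation1. Qed.

Lemma val_geX a n : val_ge v 0 a -> val_ge v 0 (a ^+ n).
Proof.
move=> ha; elim: n => [|n ih]; first exact: val_ge1.
by rewrite exprS; apply: val_geM0l.
Qed.

Lemma val_geMK n a b : a != 0 -> val_ge v n (a * b) <-> val_ge v (n - v a) b.
Proof.
move=> a0; split=> h; last first.
  by rewrite -[n](subrK (v a)) addrC; apply: val_geM => //; right.
rewrite -[b](mulKf a0) addrC; apply: val_geM => //; right.
by rewrite valuationV.
Qed.

Lemma val_ge_all_eq0 a : (forall n, val_ge v n a) -> a = 0.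
Proof.
move=> h; apply: contrapT => /eqP a0.
by have := h (v a + 1); rewrite val_ge_neq0 // gerDl.
Qed.

Lemma val_geB_trans n b a c : val_ge v n (a - b) -> val_ge v n (b - c) -> val_ge v n (a - c).
Proof. by move=> /val_geD h /h; rewrite addrA subrK. Qed.

Lemma val_ge_subr m n a b : m <= n -> val_ge v n (a - b) -> val_ge v m a <-> val_ge v m b.
Proof.
move=> mn /(val_geW mn) h; split=> [ha|hb].
  by rewrite -[b](subKr a); apply: val_geB.
by rewrite -[a](subrK b); apply: val_geD.
Qed.

(** A perturbation smaller than [a] keeps the valuation: if [v b] exceeded [v a], then
    [a = (a - b) + b] would have too large a valuation. *)
Lemma val_eq_sub n a b : a != 0 -> v a < n -> val_ge v n (a - b) -> b != 0 /\ v b = v a.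
Proof.
move=> a0 an h.
have b0 : b != 0.
  by apply: contraTneq an => b0; move: h; rewrite b0 subr0 val_ge_neq0 // leNgt.
split=> //; apply/eqP; rewrite eq_le; apply/andP; split.
  rewrite leNgt; apply/negP => ab.
  have: val_ge v (Num.min n (v b)) a.
    rewrite -[a](subrK b); apply: val_geD; first by apply: val_geW h; rewrite ge_min lexx.
    by right; rewrite ge_min lexx orbT.
  by rewrite val_ge_neq0 // leNgt lt_min an ab.
by rewrite -val_ge_neq0 // -(val_ge_subr _ h) ?ltW //; right.
Qed.

End Valuations.

(** * Finiteness of the residue ring *)

(** If [m] exceeds [q], Bernoulli's inequality makes [(m / q) ^ a] at least [1 + a / q], which is
    unbounded in [a]. *)
Lemma leq_of_exp_bound m c q : (0 < q)%N ->
  (forall a, m ^ a <= c * q ^ a)%N -> (m <= q)%N.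
Proof.
move=> q0 h; rewrite leqNgt; apply/negP => qm.
have bernoulli a : (q ^ a * (q + a) <= m ^ a * q)%N.
  elim: a => [|a ih]; first by rewrite addn0.
  apply: (@leq_trans (m * (q ^ a * (q + a)))).
    rewrite expnS -mulnA mulnCA [leqRHS]mulnCA leq_pmul2l ?expn_gt0 ?q0 //.
    by apply: (@leq_trans (q.+1 * (q + a))); rewrite ?leq_mul2r ?qm ?orbT //; nia.
  by rewrite expnS -mulnA leq_mul2l ih orbT.
(* At [a = c * q] the two bounds combine to [q + c * q <= c * q]. *)
have := leq_trans (bernoulli (c * q)%N) (leq_mul (h _) (leqnn q)).
rewrite -mulnA mulnCA leq_pmul2l ?expn_gt0 ?q0 //.
by rewrite -{2}[(c * q)%N]add0n leq_add2r leqNgt q0.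
Qed.

Lemma finite_range_collision (T : finType) (U : Type) (f : T -> U) (u : nat -> U) :
  (forall n, range f (u n)) -> exists i j, (i < j)%N /\ u i = u j.
Proof.
move=> /range_choice[g gu].
have /injectivePn[i [j ij gij]] : ~~ injectiveb (fun i : 'I_#|T|.+1 => g i).
  by apply/negP => /injectiveP/leq_card; rewrite card_ord ltnn.
wlog lt_ij : i j ij gij / (i < j)%N => [h|].
  have [lt|lt|/val_inj eq] := ltngtP i j; first exact: (h i j).
    by apply: (h j i); rewrite // eq_sym.
  by rewrite eq eqxx in ij.
by exists i, j; rewrite !gu gij.
Qed.

(** Two powers [c ^ i] and [c ^ j] of a nonzero [c] coincide, so [(j - i) * v c = 0]. *)
Lemma finite_subfield_val_ge0 (K : fieldType) (v : K -> int) (k : set K) c :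
  is_valuation v -> is_subfield k -> finite_set k -> k c -> val_ge v 0 c.
Proof.
move=> hv hk /finite_seqP[s ks] kc.
have [->|c0] := eqVneq c 0; first exact: val_ge0.
have [|i [j [ij]]] := @finite_range_collision _ _ (fun i : 'I_(size s) => s`_i)
    (fun n => c ^+ n).
  move=> n; have : k (c ^+ n) by apply: subfieldX.
  rewrite ks /= => cs; have lt : (index (c ^+ n) s < size s)%N by rewrite index_mem.
  by exists (Ordinal lt); rewrite //= nth_index.
move=> /(congr1 v); rewrite !valuationX // => eqv; right.
have /eqP : v c *+ (j - i) = 0 by rewrite mulrnBr ?eqv ?subrr // ltnW.
by rewrite mulrn_eq0 subn_eq0 leqNgt ij => /eqP->.
Qed.

Section ResidueBound.
Variables (F K : fieldType) (phi : {rmorphism F -> K}) (x : K).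
Variables (n : nat) (b : 'I_n -> K).
Local Notation E := (subfield_gen (range phi `|` [set x])).
Local Notation ev P := (map_poly phi P).[x].
Hypothesis finF : finite_set (range phi).
Hypothesis spanb : forall z, exists2 c : 'I_n -> K, forall i, E (c i) & z = \sum_i c i * b i.

Variables (v : K -> int) (t : K).
Hypotheses (hv : is_valuation v) (t0 : t != 0) (vt : 0 < v t).

(** Horner form of the sum of the [z (l_j) * t ^ j], lowest digit first. *)
Let digits m (z : 'I_m -> K) (l : seq 'I_m) := foldr (fun i y => z i + t * y) 0 l.

Let digits_ge0 m (z : 'I_m -> K) l : (forall i, val_ge v 0 (z i)) -> val_ge v 0 (digits z l).
Proof.
move=> z0; elim: l => [|i l ih] /=; first exact: val_ge0.
by apply: val_geD => //; apply: val_geM0l => //; right; apply: ltW.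
Qed.

(** The first digits agree modulo [t], hence are equal; they cancel, and division by [t] leaves
    shorter strings. *)
Let digits_inj m (z : 'I_m -> K) l l' : (forall i, val_ge v 0 (z i)) ->
  (forall i j, val_ge v (v t) (z i - z j) -> i = j) ->
  size l = size l' -> digits z l = digits z l' -> l = l'.
Proof.
move=> z0 zinj; elim: l l' => [|i l ih] [|j l'] //= [sl] eq.
have ij : i = j.
  apply: zinj; have -> : z i - z j = t * (digits z l' - digits z l).
    by rewrite mulrBr -[t * digits z l'](addKr (z j)) -eq; ring.
  by apply: val_geM0r => //; [right|apply: val_geB => //; apply: digits_ge0].
move: eq; rewrite ij => /addrI/(mulfI t0) eq; congr (_ :: _); exact: ih.
Qed.

(* If z lists m pairwise incongruent integral elements, the m ^ a sums
   \sum_(j < a) z (i j) * t ^ j are distinct.  After clearing denominators they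
   are combinations of b with polynomial coefficients in x of degree O(a), so
   there are at most C * Q ^ a of them, with Q independent of z. *)
Lemma residue_bound : exists B : nat, forall m (z : 'I_m -> K),
  (forall i, val_ge v 0 (z i)) ->
  (forall i j, val_ge v (v t) (z i - z j) -> i = j) -> (m <= B)%N.
Proof.
have /finite_seqP[s Es] := finF.
have s0 : (0 < size s)%N.
  have : [set` s] (phi 0) by rewrite -Es; exists 0.
  by rewrite /= -index_mem; apply: leq_ltn_trans.
have [D [h0 [D0 Dtb]]] := common_denominator spanb [seq t * b i | i <- enum 'I_n].
have {}Dtb i : bounded_comb phi x b h0 (ev D * (t * b i)).
  by apply: Dtb; apply: map_f; rewrite mem_enum.
pose h1 := maxn h0 (size D).
(* Each further digit raises the degree bound by [h1] and so multiplies the count by this factor. It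
   depends on [t] and [b] only; the denominators of [z] affect just the constant
   [size s ^ (n * h)]. *)
exists (size s ^ (n * h1))%N => m z z0 zinj.
have [Q [h [Q0 Qz]]] := common_denominator spanb [seq z i | i <- enum 'I_m].
have {}Qz i : bounded_comb phi x b h (ev Q * z i).
  by apply: Qz; apply: map_f; rewrite mem_enum.
have Dpow a y : bounded_comb phi x b h y -> bounded_comb phi x b (h + a * h1) (ev D ^+ a * y).
  move=> hy; elim: a => [|a iha]; first by rewrite mul1r addn0.
  rewrite exprS -mulrA mulSn addnCA addnC.
  by apply: bounded_combM iha; apply: leq_maxr.
have bnd l : bounded_comb phi x b (h + size l * h1) (ev D ^+ size l * ev Q * digits z l).
  elim: l => [|i l ih]; first by rewrite mulr0; apply: bounded_comb0.
  have -> : ev D ^+ (size l).+1 * ev Q * (z i + t * digits z l) =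
     ev D ^+ (size l).+1 * (ev Q * z i) + ev D * t * (ev D ^+ size l * ev Q * digits z l).
    by rewrite exprS; ring.
  apply: bounded_combD.
    exact: (Dpow (size l).+1).
  rewrite mulSn addnCA addnC; apply: bounded_combMt ih => j.
  by apply: bounded_combW (Dtb j); apply: leq_maxl.
apply: (@leq_of_exp_bound _ (size s ^ (n * h))%N) => [|a]; first by rewrite expn_gt0 s0.
have [|f fP] := @bounded_comb_finite _ _ phi x _ b (h + a * h1) s; first by rewrite Es.
have /range_choice[g gP] (l : a.-tuple 'I_m) : range f (ev D ^+ a * ev Q * digits z l).
  by apply: fP; have := bnd l; rewrite size_tuple.
have ginj : injective g.
  move=> l l' eqg; apply: val_inj; apply: digits_inj z0 zinj _ _.
    by rewrite !size_tuple.
  have := gP l; rewrite eqg -gP; apply: mulfI.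
  by rewrite mulf_neq0 // expf_neq0.
have := leq_card g ginj.
rewrite card_tuple card_ffun card_prod !card_ord mulnDr expnD -expnM.
by rewrite -[in (n * h1 * a)%N]mulnA [(h1 * a)%N]mulnC.
Qed.

End ResidueBound.

(** * A basis of the residue ring over the constants *)

Section ResidueBasis.
Variables (K : fieldType) (v : K -> int) (k : set K) (t : K).

Definition independent_mod d (b : 'I_d -> K) :=
  forall c : 'I_d -> K, (forall i, k (c i)) ->
    val_ge v (v t) (\sum_i c i * b i) -> forall i, c i = 0.

Definition spanning_mod d (b : 'I_d -> K) :=
  forall y, val_ge v 0 y -> exists2 c : 'I_d -> K, forall i, k (c i) &
    val_ge v (v t) (y - \sum_i c i * b i).

Hypotheses (hv : is_valuation v) (hk : is_subfield k).
Hypothesis k0 : forall c, k c -> val_ge v 0 c.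

Lemma independent_mod_inj d (b : 'I_d -> K) : independent_mod b ->
  forall i j, val_ge v (v t) (b i - b j) -> i = j.
Proof.
move=> indb i j bij; apply/eqP/negPn/negP => ij.
(* Coefficients 1 at [i] and -1 at [j] would give a nontrivial relation modulo [t]. *)
have := indb (fun l => (l == i)%:R - (l == j)%:R).
have sumE l : \sum_(u < d) (u == l)%:R * b u = b l.
  rewrite (bigD1 l) //= eqxx mul1r big1 ?addr0 // => u /negPf->.
  by rewrite mul0r.
under eq_bigr do rewrite mulrBl.
rewrite sumrB !sumE => /(_ _ bij i); rewrite eqxx (negPf ij) subr0.
have kb (B : bool) : k B%:R by case: B; [apply: subfield1|apply: subfield0].
by move=> h; have /eqP := h (fun l => subfieldB hk (kb _) (kb _)); rewrite oner_eq0.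
Qed.

(** The bound yields an independent family of maximal size. A [y] outside its span could be
    adjoined: in a relation involving [y], the coefficient of [y] is invertible in [k], and its
    inverse is integral. *)
Lemma residue_basis B :
  (forall m (z : 'I_m -> K), (forall i, val_ge v 0 (z i)) ->
    (forall i j, val_ge v (v t) (z i - z j) -> i = j) -> (m <= B)%N) ->
  exists d (b : 'I_d -> K), [/\ forall i, val_ge v 0 (b i), independent_mod b &
    spanning_mod b].
Proof.
move=> bnd.
pose P d := exists2 b : 'I_d -> K, forall i, val_ge v 0 (b i) & independent_mod b.
have exP : exists d, `[< P d >].
  by exists 0%N; apply/asboolP; exists (fun => 0) => [i|c _ _ []//]; left.
have ubP d : `[< P d >] -> (d <= B)%N.
  by move=> /asboolP[b b0 /independent_mod_inj]; apply: bnd.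
case: (ex_maxnP exP ubP) => d /asboolP[b b0 indb] maxd.
exists d, b; split=> // y y0.
have nP : ~ P d.+1 by move=> /asboolP/maxd; rewrite ltnn.
apply: contrapT => nspan; apply: nP.
exists (fun i => if unlift ord0 i is Some j then b j else y) => [i|c kc].
  by case: unliftP.
rewrite big_ord_recl unlift_none; under eq_bigr do rewrite liftK.
have [c0|c0] := eqVneq (c ord0) 0.
  rewrite c0 mul0r add0r => /indb ind i.
  by case: (unliftP ord0 i) => [j|] -> //; apply: ind.
move=> rel; case: nspan; exists (fun j => - (c ord0)^-1 * c (lift ord0 j)) => [j|].
  apply: subfieldM => //; rewrite -sub0r -div1r.
  exact: (subfieldB hk (subfield0 hk) (subfield_div hk (subfield1 hk) (kc _))).
have -> : y - \sum_j - (c ord0)^-1 * c (lift ord0 j) * b j =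
    (c ord0)^-1 * (c ord0 * y + \sum_j c (lift ord0 j) * b j).
  rewrite mulrDr mulKf // mulr_sumr -sumrN; congr (_ + _).
  by apply: eq_bigr => j _; rewrite mulNr mulNr opprK mulrA.
apply: val_geM0l => //; apply: k0.
by rewrite -div1r; apply: subfield_div => //; apply: subfield1.
Qed.

End ResidueBasis.

Lemma val_closure_subfield (K : fieldType) (v : K -> int) (E : set K) :
  is_valuation v -> is_subfield E -> is_subfield (val_closure v E).
Proof.
move=> hv hE; split.
- by apply/mem_set => M; exists 1; [exact: subfield1|rewrite subrr; left].
- move=> x y /set_mem cx /set_mem cy; apply/mem_set => M.
  have [s Es sx] := cx M; have [s' Es' sy] := cy M.
  exists (s - s'); first exact: subfieldB.
  have -> : s - s' - (x - y) = (s - x) - (s' - y) by ring.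
  exact: val_geB.
- move=> x y /set_mem cx /set_mem cy; apply/mem_set => M.
  have [->|y0] := eqVneq y 0.
    by exists 0; [exact: subfield0|rewrite invr0 mulr0 subrr; left].
  (* The first bound gives [s'] the valuation of [y]; the second absorbs the loss from dividing by
     [s' * y], of valuation [2 * v y]. *)
  pose N := Num.max (v y + 1) (M + v y *+ 2 - Num.min (v x) (v y)).
  have [s Es sx] := cx N; have [s' Es' sy] := cy N.
  have [||s'0 vs'] := @val_eq_sub _ _ hv N y s' y0; first by rewrite /N; lia.
    by rewrite -opprB; apply: val_geN.
  exists (s / s'); first exact: subfield_div.
  have -> : s / s' - x / y = (s' * y)^-1 * ((s - x) * y - x * (s' - y)).
    by field; rewrite s'0 y0.
  have xv : val_ge v (v x) x by right.
  have yv : val_ge v (v y) y by right.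
  have h : val_ge v (N + Num.min (v x) (v y)) ((s - x) * y - x * (s' - y)).
    apply: val_geB => //.
      by apply: val_geW (val_geM hv sx yv); lia.
    by apply: val_geW (val_geM hv xv sy); lia.
  apply: val_geW (val_geM hv _ h); last by right.
  by rewrite valuationV ?mulf_neq0 // valuationM // vs' /N; lia.
Qed.

(** * Expansions *)

Section Expansions.
Variables (Kv : fieldType) (w : Kv -> int) (hw : is_valuation w).
Variables (pi : Kv) (pi0 : pi != 0) (wpi : 0 < w pi).
Variables (Gamma : set Kv) (hGamma : complete_representatives w Gamma pi).

Lemma val_ge_piM y : val_ge w (w pi) y <-> ((fun z => pi * z) @` val_ring w) y.
Proof.
split=> [h|[z z0 <-]]; last by apply: val_geM0r => //; right.
exists (pi^-1 * y); last by rewrite mulVKf.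
by apply/(val_geMK hw); rewrite ?invr_eq0 // valuationV // opprK add0r.
Qed.

Lemma representatives_ge0 g : Gamma g -> val_ge w 0 g.
Proof. by case: hGamma => h _ /h. Qed.

(** The default 0 occurs only if [y] has no congruent representative, which [digitP] rules out for
    integral [y]. *)
Definition digit y := xget 0 [set g | Gamma g /\ val_ge w (w pi) (y - g)].

Lemma digitP y : val_ge w 0 y -> Gamma (digit y) /\ val_ge w (w pi) (y - digit y).
Proof.
move=> y0; case: hGamma => _ /(_ _ y0)[g [[Gg yg] _]].
have h : [set g | Gamma g /\ val_ge w (w pi) (y - g)] g by split=> //; apply/val_ge_piM.
exact: (xgetPex 0 (ex_intro _ g h)).
Qed.

Lemma digit_unique y g : val_ge w 0 y -> Gamma g -> val_ge w (w pi) (y - g) -> g = digit y.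
Proof.
move=> y0 Gg yg; have [Gd yd] := digitP y0.
case: hGamma => _ /(_ _ y0)[g' [_ uniq]].
by transitivity g'; [symmetry|]; apply: uniq; split=> //; apply/val_ge_piM.
Qed.

Definition shift y := (y - digit y) / pi.

Lemma shift_ge0 y : val_ge w 0 y -> val_ge w 0 (shift y).
Proof.
move=> /digitP[_ h]; rewrite /shift mulrC; apply/(val_geMK hw); rewrite ?invr_eq0 //.
by rewrite valuationV // opprK add0r.
Qed.

Lemma iter_shift_ge0 y n : val_ge w 0 y -> val_ge w 0 (iter n shift y).
Proof. by move=> y0; elim: n => [//|n ih] /=; apply: shift_ge0. Qed.

Lemma digits_sum y n :
  y = \sum_(k < n) digit (iter k shift y) * pi ^+ k + pi ^+ n * iter n shift y.
Proof.
elim: n => [|n ih]; first by rewrite big_ord0 add0r mul1r.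
rewrite big_ord_recr /= {1}ih -addrA; congr (_ + _).
by rewrite /(shift (iter n shift y)) exprS; field.
Qed.

Lemma val_ge_piX n y : val_ge w 0 y -> val_ge w n%:Z (pi ^+ n * y).
Proof.
move=> y0; apply: val_geM0r => //; right.
by rewrite valuationX //; elim: n => [//|n ih]; rewrite mulrS; lia.
Qed.

(** By [digits_sum] the difference is divisible by every power of [pi]. *)
Lemma digits_eq y y' : val_ge w 0 y -> val_ge w 0 y' ->
  (forall k, digit (iter k shift y) = digit (iter k shift y')) -> y = y'.
Proof.
move=> y0 y0' eq; apply/eqP; rewrite -subr_eq0; apply/eqP.
apply: (val_ge_all_eq0 (v := w)) => n.
rewrite (digits_sum y `|n|%N) (digits_sum y' `|n|%N).
under eq_bigr do rewrite eq.
rewrite opprD addrACA subrr add0r.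
have h z : val_ge w 0 z -> val_ge w n (pi ^+ `|n|%N * z).
  by move=> z0; apply: val_geW (val_ge_piX `|n|%N z0); lia.
by apply: val_geB => //; apply: h; apply: iter_shift_ge0.
Qed.

(** The integral partial sums make [y] integral. All terms but the first are divisible by [pi], so
    [b 0] is the digit of [y], and the remaining coefficients expand [shift y]. *)
Lemma expansion0P y (b : nat -> Kv) :
  ((forall k, Gamma (b k)) /\ val_cvg w (fun N => \sum_(k < N) b k * pi ^+ k) y) <->
  val_ge w 0 y /\ forall k, b k = digit (iter k shift y).
Proof.
split=> [[Gb cv]|[y0 bE]]; last first.
  split=> [k|M]; first by rewrite bE; case: (digitP (iter_shift_ge0 k y0)).
  exists `|M|%N => n Mn.
  under eq_bigr do rewrite bE.
  rewrite {2}(digits_sum y n) opprD addrA subrr add0r; apply: val_geN => //.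
  by apply: val_geW (val_ge_piX n (iter_shift_ge0 n y0)); lia.
have tail (b' : nat -> Kv) y' : (forall k, Gamma (b' k)) ->
    val_cvg w (fun N => \sum_(k < N) b' k * pi ^+ k) y' -> val_ge w 0 y'.
  move=> Gb' /(_ 0)[N /(_ N (leqnn N)) h]; apply/(val_ge_subr hw (lexx 0) h).
  apply: val_ge_sum => // k _; apply: val_geM0r => //; first exact: representatives_ge0.
  by apply: val_geX => //; right; apply: ltW.
split=> [|k]; first exact: tail Gb cv.
elim: k y b Gb cv => [|k ih] y b Gb cv; last rewrite iterSr -(ih _ (fun k => b k.+1)) //.
(* Two goals remain, the leading digit and the convergence of the shifted sums to [shift y]; they
   share the facts below. *)
all: have y0 := tail _ _ Gb cv.
all: have cv' : val_cvg w (fun N => \sum_(k < N) b k.+1 * pi ^+ k) ((y - b 0%N) / pi).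
(* Division by [pi] costs [w pi] of precision, and [n] shifted terms come from [n.+1] original
   ones. *)
1,3: move=> M; have [N hN] := cv (M + w pi); exists N => n Nn.
1,2: have := hN n.+1 (leqW Nn); rewrite big_ord_recl /= expr0 mulr1.
1,2: under eq_bigr do rewrite /bump exprS mulrCA.
1,2: rewrite -mulr_sumr => h; rewrite -(addrK (w pi) M); apply/(val_geMK hw) => //.
1,2: by congr (val_ge _ _ _): h; field.
all: have b0 : b 0%N = digit y.
1,3: apply: digit_unique => //; rewrite -[y - _](mulfVK pi0) mulrC.
1,2: by apply: val_geM0r => //; [right|exact: (tail _ _ (fun k => Gb k.+1) cv')].
- exact: b0.
- by rewrite /shift -b0.
Qed.

Lemma expansionP x m a : is_expansion w Gamma pi x m a <->
  val_ge w 0 (x * pi ^ (- m)) /\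
  forall k : nat, a (m + k%:Z) = digit (iter k shift (x * pi ^ (- m))).
Proof.
rewrite -(expansion0P _ (fun k : nat => a (m + k%:Z))).
have pim : pi ^ m != 0 by rewrite expfz_neq0.
have sumE N : \sum_(k < N) a (m + k%:Z) * pi ^ (m + k%:Z) - x =
    pi ^ m * (\sum_(k < N) a (m + k%:Z) * pi ^+ k - x * pi ^ (- m)).
  rewrite mulrBr mulr_sumr -invr_expz; congr (_ - _); last by rewrite mulrC mulfVK.
  by apply: eq_bigr => k _; rewrite expfzDr // mulrCA.
split=> -[G cv]; split=> [k|M].
- by apply: G; rewrite lerDl.
- have [N hN] := cv (M + w (pi ^ m)); exists N => n /hN.
  by rewrite sumE (val_geMK hw) // addrK.
- by move=> mk; have := G `|k - m|%N; congr (Gamma (a _)); lia.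
- have [N hN] := cv (M - w (pi ^ m)); exists N => n /hN.
  by rewrite sumE (val_geMK hw).
Qed.

(** Periodicity from some index on says that two iterates have the same digits, hence are equal by
    [digits_eq]; a repeated iterate repeats all later digits. *)
Lemma ultimately_periodicP m a y : val_ge w 0 y ->
  (forall k : nat, a (m + k%:Z) = digit (iter k shift y)) ->
  ultimately_periodic m a <->
  exists i j, (i < j)%N /\ iter i shift y = iter j shift y.
Proof.
move=> y0 aE; split=> [[N [L [mN L0 per]]]|[i [j [ij eq]]]].
  exists `|N - m|%N, (`|N - m| + `|L|)%N; split; first by lia.
  apply: digits_eq => [||k]; try exact: iter_shift_ge0.
  rewrite -!iterD -!aE -per; last by lia.
  by congr a; lia.
exists (m + i%:Z), (j - i)%:Z; split; [lia|lia|] => n mn.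
have [r ->] : exists r : nat, n = m + (r + i)%:Z.
  by exists (absz (n - m - i%:Z)%R); lia.
have -> : m + (r + i)%:Z + (j - i)%:Z = m + (r + j)%:Z by lia.
by rewrite !aE !iterD eq.
Qed.

Lemma one_sub_piX_neq0 n : 1 - pi ^+ n.+1 != 0.
Proof.
apply/eqP => /eqP; rewrite subr_eq0 => /eqP/(congr1 w).
by rewrite valuation1 // valuationX // mulrS; nia.
Qed.

(* y = P + pi ^ i * z with z * (1 - pi ^ (j - i)) a polynomial in pi with
   digits as coefficients. *)
Lemma periodic_mem (S : set Kv) y i j : val_ge w 0 y ->
  S 0 -> (forall u u', S u -> S u' -> S (u + u')) -> Gamma `<=` S ->
  (forall u, S u -> S (u * pi)) -> (forall n u, S u -> S (u / (1 - pi ^+ n.+1))) ->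
  (i < j)%N -> iter i shift y = iter j shift y -> S y.
Proof.
move=> y0 S0 SD SG Spi Sdiv ij eq.
have SX u n : S u -> S (u * pi ^+ n).
  by move=> Su; elim: n => [|n ih]; rewrite ?mulr1 // exprSr mulrA; apply: Spi.
have Ssum z n : val_ge w 0 z -> S (\sum_(k < n) digit (iter k shift z) * pi ^+ k).
  move=> z0; apply: big_ind => // k _; apply: SX; apply: SG.
  by case: (digitP (iter_shift_ge0 k z0)).
rewrite (digits_sum y i); apply: SD; first exact: Ssum.
rewrite mulrC; apply: SX; set z := iter i shift y.
have z0 : val_ge w 0 z by apply: iter_shift_ge0.
(* The period [j - i] is put in the successor form that [Sdiv] expects. *)
have zE : z = iter (j - i.+1).+1 shift z by rewrite /z -iterD eq; congr (iter _ _ _); lia.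
have := digits_sum z (j - i.+1).+1; rewrite -zE => zsum.
have -> : z = (\sum_(k < (j - i.+1).+1) digit (iter k shift z) * pi ^+ k) /
    (1 - pi ^+ (j - i.+1).+1).
  apply: (mulIf (one_sub_piX_neq0 (j - i.+1))); rewrite divfK ?one_sub_piX_neq0 //.
  by rewrite mulrBr mulr1 {1}zsum [z * _]mulrC addrK.
by apply: Sdiv; apply: Ssum.
Qed.

(** * Property A in terms of the shift, and rationality of [pi] and the digits *)

Section Rational.
Variables (K : fieldType) (iota : {rmorphism K -> Kv}).

Lemma property_A_digits : property_A w iota Gamma pi <->
  forall y m, val_ge w 0 y ->
    range iota (y * pi ^ m) <-> exists i j, (i < j)%N /\ iter i shift y = iter j shift y.
Proof.
split=> [A y m y0|A x m a /expansionP[x0 aE]].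
  pose a n := digit (iter `|n - m|%N shift y).
  have aE (k : nat) : a (m + k%:Z) = digit (iter k shift y).
    by rewrite /a; congr (digit (iter _ _ _)); lia.
  rewrite -(ultimately_periodicP (m := m) (a := a) y0 aE); apply: A; apply/expansionP.
  by rewrite -mulrA -expfzDr // subrr mulr1.
rewrite (ultimately_periodicP x0 aE) -(A _ m x0) (_ : _ * pi ^ m = x) //.
by rewrite -mulrA -expfzDr // addNr mulr1.
Qed.

(** The constant expansion with digit [g] sums to [g / (1 - pi)], a fixed point of [shift].
    Comparing starting exponents 1 and 0 gives [pi]; multiplying by [1 - pi] then gives [g]. *)
Lemma property_A_rational : property_A w iota Gamma pi ->
  range iota pi /\ Gamma `<=` range iota.
Proof.
rewrite property_A_digits => A; have hR := range_subfield iota.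
have pi1 := one_sub_piX_neq0 0; rewrite expr1 in pi1.
have h g m : Gamma g -> range iota (g / (1 - pi) * pi ^ m).
  move=> Gg; have g0 := representatives_ge0 Gg.
  have w1 : w (1 - pi) = 0.
    have [||_ ->] := @val_eq_sub _ _ hw (w pi) 1 (1 - pi) (oner_neq0 _).
    - by rewrite valuation1.
    - by right; rewrite subKr.
    - by rewrite valuation1.
  have y0 : val_ge w 0 (g / (1 - pi)).
    by rewrite mulrC; apply/(val_geMK hw); rewrite ?invr_eq0 // valuationV // w1 !oppr0.
  have dE : g = digit (g / (1 - pi)).
    apply: digit_unique => //.
    have -> : g / (1 - pi) - g = pi * (g / (1 - pi)) by field.
    by apply: val_geM0r => //; right.
  apply/(A _ _ y0); exists 0%N, 1%N; split=> //=.
  by rewrite /shift -dE; field; rewrite pi0.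
have [Gd d1] := digitP (val_ge1 hw).
(* A nonzero representative is needed as a divisor; 1 is not divisible by [pi], so its digit
   serves. *)
have d0 : digit 1 != 0.
  apply: contraTneq wpi => d0; move: d1.
  by rewrite d0 subr0 val_ge_neq0 ?oner_neq0 // valuation1 // -leNgt.
have Rpi : range iota pi.
  have := subfield_div hR (h _ 1 Gd) (h _ 0 Gd).
  by rewrite expr1z expr0z mulr1 mulrC mulKf // mulf_neq0 ?invr_eq0.
split=> // g Gg; have := subfieldM hR (h _ 0 Gg) (subfieldB hR (subfield1 hR) Rpi).
by rewrite expr0z mulr1 divfK.
Qed.

End Rational.
End Expansions.

(** * The local basis *)

Section LocalBasis.
Variables (K Kv : fieldType) (v : K -> int) (w : Kv -> int).
Variables (iota : {rmorphism K -> Kv}).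
Hypotheses (hv : is_valuation v) (hKv : is_completion v iota w).
Variables (F : fieldType) (phi : {rmorphism F -> K}).
Hypothesis phi_ge0 : forall c, val_ge v 0 (phi c).
Variables (t : K) (t0 : t != 0) (vt : 0 < v t).

Local Notation ev P := (map_poly phi P).[t].
Local Notation E := (subfield_gen (range phi `|` [set t])).
Local Notation Ehat := (val_closure w (iota @` E)).

Let hw : is_valuation w. Proof. by case: hKv. Qed.

Lemma val_ge_iota n x : val_ge w n (iota x) <-> val_ge v n x.
Proof.
have [->|x0] := eqVneq x 0; first by rewrite rmorph0; split; left.
by rewrite !val_ge_neq0 ?fmorph_eq0 //; case: hKv => _ ->.
Qed.

Let hE : is_subfield E. Proof. exact: subfield_gen_subfield. Qed.

Lemma subfield_image (S : set K) : is_subfield S -> is_subfield (iota @` S).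
Proof.
move=> hS; split; first by apply/mem_set; exists 1; [exact: subfield1|rewrite rmorph1].
- move=> _ _ /set_mem[x Sx <-] /set_mem[y Sy <-].
  by apply/mem_set; exists (x - y); [exact: subfieldB|rewrite rmorphB].
- move=> _ _ /set_mem[x Sx <-] /set_mem[y Sy <-].
  by apply/mem_set; exists (x / y); [exact: subfield_div|rewrite fmorph_div].
Qed.

Lemma Ehat_subfield : is_subfield Ehat.
Proof. exact/val_closure_subfield/subfield_image. Qed.

Lemma Ehat_iota r : E r -> Ehat (iota r).
Proof. by move=> Er M; exists (iota r); [exists r|rewrite subrr; left]. Qed.

Lemma E_phi c : E (phi c).
Proof. by move=> M [_]; apply; left; exists c. Qed.

Lemma E_t : E t.
Proof. by move=> M [_]; apply; right. Qed.

Lemma horner_drop (P : {poly F}) : ev P = phi P`_0 + t * ev (drop_poly 1 P).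
Proof.
rewrite -{1}(poly_take_drop 1 P) expr1 rmorphD rmorphM hornerD hornerM /= map_polyX hornerX.
rewrite mulrC; congr (_ + _).
have -> : take_poly 1 P = (P`_0)%:P.
  by apply/polyP => -[|i]; rewrite coef_take_poly coefC.
by rewrite map_polyC hornerC.
Qed.

Lemma horner_ge0 (P : {poly F}) : val_ge v 0 (ev P).
Proof.
rewrite horner_coef; apply: val_ge_sum => // i _; rewrite coef_map.
by apply: val_geM0l => //; [exact: phi_ge0|apply: val_geX] => //; right; apply: ltW.
Qed.

Lemma horner_mod (P : {poly F}) : val_ge v (v t) (ev P - phi P`_0).
Proof.
rewrite horner_drop addrC addKr.
by apply: val_geM0r => //; [right|exact: horner_ge0].
Qed.

Lemma val_phi c : c != 0 -> v (phi c) = 0.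
Proof.
move=> c0; apply/eqP; rewrite eq_le.
have := phi_ge0 c^-1; rewrite fmorphV val_ge_neq0 ?invr_eq0 ?fmorph_eq0 //.
rewrite valuationV ?fmorph_eq0 // oppr_ge0 => ->.
by have := phi_ge0 c; rewrite val_ge_neq0 ?fmorph_eq0.
Qed.

Lemma phi_mod_eq0 c : val_ge v (v t) (phi c) -> c = 0.
Proof.
move=> h; apply/eqP/negPn/negP => c0; move: h.
by rewrite val_ge_neq0 ?fmorph_eq0 // val_phi // leNgt vt.
Qed.

(** If [Q] has constant term 0, integrality forces the same for [P], and a factor [t] cancels.
    Otherwise the fraction reduces to the quotient of the constant terms. *)
Lemma residue_fraction r : E r -> val_ge v 0 r -> exists c, val_ge v (v t) (r - phi c).
Proof.
move=> /subfield_gen_fraction[P [Q [Q0 ->]]].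
elim: {Q}(size Q) {-2}Q (leqnn (size Q)) P Q0 => [|n ih] Q sQ P Q0 r0.
  by move: sQ Q0; rewrite leqn0 size_poly_eq0 => /eqP->; rewrite rmorph0 horner0 eqxx.
have [q0|q0] := eqVneq Q`_0 0.
  have evQ : ev Q = t * ev (drop_poly 1 Q) by rewrite horner_drop q0 rmorph0 add0r.
  have p0 : P`_0 = 0.
    apply: phi_mod_eq0; have := horner_mod P; rewrite -opprB => /(val_geN hv); rewrite opprK.
    move=> h; apply/(val_ge_subr hv (lexx _) h).
    rewrite -(divfK Q0 (ev P)); apply: val_geM0l => //; rewrite evQ.
    by apply: val_geM0r => //; [right|exact: horner_ge0].
  have evP : ev P = t * ev (drop_poly 1 P) by rewrite horner_drop p0 rmorph0 add0r.
  have Q'0 : ev (drop_poly 1 Q) != 0 by move: Q0; rewrite evQ mulf_eq0 negb_or => /andP[].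
  have rE : ev P / ev Q = ev (drop_poly 1 P) / ev (drop_poly 1 Q).
    by rewrite evP evQ; field; rewrite t0 Q'0.
  rewrite rE in r0 *; apply: ih => //.
  by rewrite size_drop_poly leq_subLR add1n.
have vq : v (phi Q`_0) = 0 by apply: val_phi.
have fq0 : phi Q`_0 != 0 by rewrite fmorph_eq0.
have [||_ vQ] := @val_eq_sub _ _ hv (v t) (phi Q`_0) (ev Q) fq0.
- by rewrite vq.
- by rewrite -opprB; apply/val_geN/horner_mod.
exists (P`_0 / Q`_0); rewrite fmorph_div.
have -> : ev P / ev Q - phi P`_0 / phi Q`_0 = (ev Q * phi Q`_0)^-1 *
    ((ev P - phi P`_0) * phi Q`_0 - phi P`_0 * (ev Q - phi Q`_0)).
  by field; rewrite fq0 Q0.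
apply: val_geM0l => //.
  by right; rewrite valuationV ?mulf_neq0 // valuationM // vQ vq.
by apply: val_geB => //; [apply: val_geM0r|apply: val_geM0l] => //; apply: horner_mod.
Qed.

Lemma residue_closure r : Ehat r -> val_ge w 0 r ->
  exists c, val_ge w (v t) (r - iota (phi c)).
Proof.
move=> Er r0; have [_ [s Es <-] sr] := Er (v t).
have s0 : val_ge v 0 s by apply/val_ge_iota/(val_ge_subr hw (ltW vt) sr).
have [c sc] := residue_fraction Es s0.
exists c; apply: (val_geB_trans hw (b := iota s)); first by rewrite -opprB; apply: val_geN.
by rewrite -rmorphB; apply/val_ge_iota.
Qed.

Variables (d : nat) (b : 'I_d -> K).
Hypotheses (b0 : forall i, val_ge v 0 (b i)) (indb : independent_mod v (range phi) t b).
Hypothesis spanb : spanning_mod v (range phi) t b.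

(** Dividing by a coefficient of least valuation makes all coefficients integral and one of them 1.
    Modulo [t] this is a relation with constant coefficients, which [indb] forces to vanish, against
    the coefficient 1. *)
Lemma independent_closure (r : 'I_d -> Kv) : (forall i, Ehat (r i)) ->
  \sum_i r i * iota (b i) = 0 -> forall i, r i = 0.
Proof.
move=> Er sum0 i; apply/eqP/negPn/negP => ri.
case: (@Order.TotalTheory.arg_minP _ _ _ _ (fun j => r j != 0) (fun j => w (r j)) ri) => j rj minj.
have hj l : Ehat (r l / r j) /\ val_ge w 0 (r l / r j).
  split; first exact: (subfield_div Ehat_subfield).
  have [->|rl] := eqVneq (r l) 0; first by rewrite mul0r; left.
  by right; rewrite valuationM ?invr_eq0 // valuationV // subr_ge0 minj.
have [c cP] := choice (fun l => residue_closure (hj l).1 (hj l).2).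
have sumc : val_ge v (v t) (\sum_l phi (c l) * b l).
  apply/val_ge_iota; rewrite rmorph_sum.
  have -> : \sum_l iota (phi (c l) * b l) =
      - \sum_l (r l / r j - iota (phi (c l))) * iota (b l).
    under [in RHS]eq_bigr do rewrite mulrBl mulrAC.
    rewrite sumrB -mulr_suml sum0 mul0r sub0r opprK.
    by apply: eq_bigr => l _; rewrite rmorphM.
  apply: val_geN => //; apply: val_ge_sum => // l _; apply: val_geM0r => //.
  exact/val_ge_iota.
have phic l : range phi (phi (c l)) by exists (c l).
have := cP j; rewrite (indb phic sumc) rmorph0 subr0 divff //.
by rewrite val_ge_neq0 ?oner_neq0 // valuation1 // leNgt vt.
Qed.

Lemma independent_global (r : 'I_d -> K) : (forall i, E (r i)) ->
  \sum_i r i * b i = 0 -> forall i, r i = 0.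
Proof.
move=> Er /(congr1 iota); rewrite rmorph_sum rmorph0.
under eq_bigr do rewrite rmorphM.
move=> /(independent_closure (fun i => Ehat_iota (Er i))) r0 i.
by apply/eqP; rewrite -(fmorph_eq0 iota) r0.
Qed.

Lemma approximate_digits y : val_ge w 0 y ->
  exists c : 'I_d -> F, val_ge w (v t) (y - \sum_i iota (phi (c i) * b i)).
Proof.
move=> y0; have [_ _ dense _] := hKv.
have cl : val_closure w (range iota) y by rewrite dense.
have [_ [z _ <-] zy] := cl (v t).
have z0 : val_ge v 0 z by apply/val_ge_iota/(val_ge_subr hw (ltW vt) zy).
have [c /range_choice[c' cE] zc] := spanb z0.
exists c'; apply: (val_geB_trans hw (b := iota z)); first by rewrite -opprB; apply: val_geN.
rewrite -rmorph_sum -rmorphB; apply/val_ge_iota.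
by under eq_bigr do rewrite -cE.
Qed.

Lemma val_cauchy_sum (f : nat -> Kv) : (forall k, val_ge w k%:Z (f k)) ->
  val_cauchy w (fun n => \sum_(k < n) f k).
Proof.
move=> fk M; exists `|M|%N.
suff h i j : (`|M| <= i)%N -> (i <= j)%N ->
    val_ge w M (\sum_(k < j) f k - \sum_(k < i) f k).
  move=> i j Mi Mj; have [/ltnW ij|ji] := ltnP i j; last exact: h.
  by rewrite -opprB; apply: val_geN => //; apply: h.
move=> Mi ij; rewrite -!(big_mkord xpredT) (big_cat_nat _ (n := i)) //= addrC addrK.
rewrite big_nat_cond; apply: val_ge_sum => // k /andP[/andP[ik _] _].
by apply: val_geW (fk k); lia.
Qed.

(** Repeated approximation modulo [t] gives [x] as a combination of [b] with polynomial coefficients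
    [u i n], up to [t ^ n]. These coefficients converge, and their limits lie in the closure of
    [E]. *)
Lemma spanning_closure_ge0 x : val_ge w 0 x ->
  exists2 r : 'I_d -> Kv, forall i, Ehat (r i) & x = \sum_i r i * iota (b i).
Proof.
move=> x0.
have [c cP] : exists c : Kv -> 'I_d -> F, forall y, val_ge w 0 y ->
    val_ge w (v t) (y - \sum_i iota (phi (c y i) * b i)).
  have h y : exists c : 'I_d -> F, val_ge w 0 y ->
      val_ge w (v t) (y - \sum_i iota (phi (c i) * b i)).
    have [y0|ny] := pselect (val_ge w 0 y); last by exists (fun => 0).
    by have [c cP] := approximate_digits y0; exists c.
  by have [c] := choice h; exists c.
have it0 : iota t != 0 by rewrite fmorph_eq0.
have wt : w (iota t) = v t by case: hKv => _ ->.
pose next y := (y - \sum_i iota (phi (c y i) * b i)) / iota t.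
pose X n := iter n next x.
have X0 n : val_ge w 0 (X n).
  elim: n => [//|n ih]; rewrite /= /next mulrC; apply/(val_geMK hw); rewrite ?invr_eq0 //.
  by rewrite valuationV // opprK add0r wt; apply: cP.
pose u i n := \sum_(k < n) phi (c (X k) i) * t ^+ k.
have sumX n : x = \sum_i iota (u i n) * iota (b i) + iota t ^+ n * X n.
  elim: n => [|n ih].
    by rewrite mul1r big1 ?add0r // => i _; rewrite /u big_ord0 rmorph0 mul0r.
  rewrite {1}ih.
  have -> : X n = \sum_i iota (phi (c (X n) i) * b i) + iota t * X n.+1.
    by rewrite /= /next mulrC divfK // addrC subrK.
  rewrite mulrDr mulrA -exprSr addrA; congr (_ + _).
  rewrite mulr_sumr -big_split; apply: eq_bigr => i _ /=.
  by rewrite /u big_ord_recr /= !rmorphD !rmorphM rmorphXn /=; ring.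
have cauchy i : val_cauchy w (fun n => iota (u i n)).
  rewrite (_ : (fun n => _) = fun n => \sum_(k < n) iota (phi (c (X k) i) * t ^+ k)).
    apply: (val_cauchy_sum (f := fun k => iota (phi (c (X k) i) * t ^+ k))) => k.
    rewrite mulrC rmorphM rmorphXn; apply: val_ge_piX => //.
      by rewrite wt.
    by apply/val_ge_iota; apply: phi_ge0.
  by apply/funext => n; rewrite rmorph_sum.
have [r rP] : exists r, forall i, val_cvg w (fun n => iota (u i n)) (r i).
  have [_ _ _ compl] := hKv; have [r] := choice (fun i => compl _ (cauchy i)).
  by exists r.
exists r => [i M|].
  have [N /(_ N (leqnn N)) h] := rP i M; exists (iota (u i N)) => //.
  exists (u i N) => //; apply: (subfield_sum hE) => k _.
  exact: (subfieldM hE (E_phi _) (subfieldX hE _ E_t)).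
apply/eqP; rewrite -subr_eq0; apply/eqP; apply: (val_ge_all_eq0 (v := w)) => M.
have [N NP] := choice (fun i => rP i M).
(* Large enough for the remainder [t ^ n * X n] and for every coordinate to be within precision
   [M]. *)
pose n := maxn `|M| (\max_i N i).
rewrite (sumX n) addrAC -sumrB; apply: val_geD => //.
  apply: val_ge_sum => // i _; rewrite -mulrBl; apply: val_geM0r => //; last exact/val_ge_iota.
  by apply: NP; rewrite leq_max (leq_bigmax i) orbT.
apply: val_geW (val_ge_piX hw it0 _ n (X0 n)); last by rewrite wt.
by rewrite /n; lia.
Qed.

Lemma closure_basis : is_basis Ehat (fun i => iota (b i)).
Proof.
split=> [|x]; first exact: independent_closure.
have it0 : iota t != 0 by rewrite fmorph_eq0.
have wt : w (iota t) = v t by case: hKv => _ ->.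
have tn0 : iota t ^+ `|w x| != 0 by rewrite expf_neq0.
(* As [v t] is at least 1, this power of [t] makes [x] integral. *)
have [|r Er xE] := @spanning_closure_ge0 (iota t ^+ `|w x| * x).
  apply/(val_geMK hw) => //; right.
  by rewrite sub0r valuationX // wt; nia.
exists (fun i => r i / iota t ^+ `|w x|) => [i|].
  exact: (subfield_div Ehat_subfield (Er i) (subfieldX Ehat_subfield _ (Ehat_iota E_t))).
apply: (mulfI tn0); rewrite xE mulr_sumr; apply: eq_bigr => i _.
by rewrite mulrA [_ * (r i / _)]mulrC divfK.
Qed.

(** Independence modulo [t] kills the constant terms of the differences [P i - Q i], so division by
    [t] drops a coefficient and the degree bound survives. *)
Lemma bounded_comb_shift h y y' : bounded_comb phi t b h y -> bounded_comb phi t b h y' ->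
  val_ge v (v t) (y - y') -> bounded_comb phi t b h ((y - y') / t).
Proof.
move=> [P [sP ->]] [Q [sQ ->]] yy'.
pose R i := P i - Q i.
have sumR : \sum_i ev (P i) * b i - \sum_i ev (Q i) * b i = \sum_i ev (R i) * b i.
  by rewrite -sumrB; apply: eq_bigr => i _; rewrite rmorphB hornerD hornerN mulrBl.
rewrite sumR in yy' *.
have R0 i : (R i)`_0 = 0.
  have phiR l : range phi (phi (R l)`_0) by exists (R l)`_0.
  apply/eqP; rewrite -(fmorph_eq0 phi) (indb phiR) //.
  have h0 : val_ge v (v t) (\sum_l ev (R l) * b l - \sum_l phi (R l)`_0 * b l).
    rewrite -sumrB; apply: val_ge_sum => // l _; rewrite -mulrBl.
    by apply: val_geM0r => //; apply: horner_mod.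
  exact/(val_ge_subr hv (lexx _) h0).
exists (fun i => drop_poly 1 (R i)); split=> [i|].
  rewrite size_drop_poly; apply: leq_trans (leq_subr _ _) _.
  by apply: leq_trans (size_polyD _ _) _; rewrite size_polyN geq_max sP sQ.
rewrite mulr_suml; apply: eq_bigr => i _.
by rewrite [ev (R i)]horner_drop R0 rmorph0 add0r mulrAC [t * _]mulrC mulfK.
Qed.

(** * The local ring of [E] at [t] and Nakayama's lemma *)

Definition local_subring : set K := [set r | E r /\ val_ge v 0 r].
Local Notation R := local_subring.

Lemma local_subringD r s : R r -> R s -> R (r + s).
Proof. by move=> [Er r0] [Es s0]; split; [exact: (subfieldD hE)|exact: val_geD]. Qed.

Lemma local_subringM r s : R r -> R s -> R (r * s).
Proof. by move=> [Er r0] [Es s0]; split; [exact: (subfieldM hE)|exact: val_geM0l]. Qed.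

Lemma local_subring0 : R 0.
Proof. by split; [exact: (subfield0 hE)|left]. Qed.

Lemma local_subring1 : R 1.
Proof. by split; [exact: (subfield1 hE)|exact: val_ge1]. Qed.

Lemma local_subring_t : R t.
Proof. by split; [exact: E_t|right; exact: ltW]. Qed.

(** [t * r] has positive valuation, so [1 - t * r] has valuation 0. *)
Lemma local_subring_unit r : R r -> 1 - t * r != 0 /\ R (1 - t * r)^-1.
Proof.
move=> Rr; have [tr0 tr1] : val_ge v (v t) (t * r) /\ E (t * r).
  case: Rr => Er r0; split; first by apply: val_geM0r => //; right.
  by apply: (subfieldM hE) => //; apply: E_t.
have [||n0 val] := @val_eq_sub _ _ hv (v t) 1 (1 - t * r) (oner_neq0 _).
- by rewrite valuation1.
- by rewrite subKr.
split=> //; split; last by right; rewrite valuationV // val valuation1.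
rewrite -div1r; apply: (subfield_div hE) => //; first exact: (subfield1 hE).
by apply: (subfieldB hE) => //; apply: (subfield1 hE).
Qed.

(** The [R]-module generated by [s] and [b]; the recursion lets generators from [s] be removed one
    at a time until only [b] is left. *)
Fixpoint local_span (s : seq K) : set K :=
  if s is g :: s' then
    [set z | exists r u, [/\ R r, local_span s' u & z = r * g + u]]
  else [set z | exists2 r : 'I_d -> K, forall i, R (r i) & z = \sum_i r i * b i].

Lemma local_spanD s z z' : local_span s z -> local_span s z' -> local_span s (z + z').
Proof.
elim: s z z' => [|g s ih] z z' /=.
  move=> [r Rr ->] [r' Rr' ->]; exists (fun i => r i + r' i) => [i|].
    exact: local_subringD.
  by rewrite -big_split; apply: eq_bigr => i _; rewrite mulrDl.
move=> [r [u [Rr su ->]]] [r' [u' [Rr' su' ->]]]; exists (r + r'), (u + u').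
by split; [exact: local_subringD|exact: ih|ring].
Qed.

Lemma local_spanM s r z : R r -> local_span s z -> local_span s (r * z).
Proof.
move=> Rr; elim: s z => [|g s ih] z /=.
  move=> [r' Rr' ->]; exists (fun i => r * r' i) => [i|].
    exact: local_subringM.
  by rewrite mulr_sumr; apply: eq_bigr => i _; rewrite mulrA.
move=> [r' [u [Rr' su ->]]]; exists (r * r'), (r * u).
by split; [exact: local_subringM|exact: ih|ring].
Qed.

Lemma local_span_basis s (r : 'I_d -> K) :
  (forall i, R (r i)) -> local_span s (\sum_i r i * b i).
Proof.
move=> Rr; elim: s => [|g s ih] /=; first by exists r.
by exists 0, (\sum_i r i * b i); split=> //; [exact: local_subring0|rewrite mul0r add0r].
Qed.

Lemma local_span0 s : local_span s 0.
Proof.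
have := @local_span_basis s (fun => 0) (fun => local_subring0).
by rewrite big1 // => i _; rewrite mul0r.
Qed.

Lemma local_span_mem s g : g \in s -> local_span s g.
Proof.
elim: s => [//|g' s ih]; rewrite inE => /predU1P[->|/ih sg] /=.
  by exists 1, 0; split; [exact: local_subring1|exact: local_span0|rewrite mul1r addr0].
by exists 0, g; split=> //; [exact: local_subring0|rewrite mul0r add0r].
Qed.

(* Nakayama: a generator g is congruent to a combination of b modulo t, and the
   remainder t * (r * g + u) can be solved for g because 1 - t * r is a unit. *)
Lemma local_span_nakayama s : (forall g, g \in s -> val_ge v 0 g) ->
  (forall z, val_ge v 0 z -> local_span s z) ->
  forall z, val_ge v 0 z -> local_span [::] z.
Proof.
elim: s => [//|g s ih] s0 spans; apply: ih => [g' gs|z z0].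
  by apply: s0; rewrite inE gs orbT.
suff sg : local_span s g.
  have [r [u [Rr su ->]]] := spans z z0.
  by apply: local_spanD => //; apply: local_spanM.
have g0 : val_ge v 0 g by apply: s0; rewrite mem_head.
have [c kc cg] := spanb g0.
pose y := t^-1 * (g - \sum_i c i * b i).
have /spans[r [u [Rr su yE]]] : val_ge v 0 y.
  by apply/(val_geMK hv); rewrite ?invr_eq0 // valuationV // opprK add0r.
have [n0 Rinv] := local_subring_unit Rr.
have -> : g = (1 - t * r)^-1 * (\sum_i c i * b i + t * u).
  apply: (mulfI n0); rewrite mulVKf //.
  have gE : g = \sum_i c i * b i + t * (r * g + u) by rewrite -yE /y mulVKf // addrC subrK.
  by rewrite mulrBl mul1r {1}gE; ring.
apply: local_spanM => //; apply: local_spanD; last first.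
  by apply: local_spanM => //; exact: local_subring_t.
by apply: local_span_basis => i; have [a _ <-] := kc i; split=> //; apply: E_phi.
Qed.

Lemma global_basis : (forall z, val_ge v 0 z -> local_span [::] z) -> is_basis E b.
Proof.
move=> spans; split=> [|x]; first exact: independent_global.
have tn0 : t ^+ `|v x| != 0 by rewrite expf_neq0.
have [|r Rr xE] := spans (t ^+ `|v x| * x).
  by apply/(val_geMK hv) => //; right; rewrite sub0r valuationX //; nia.
exists (fun i => r i / t ^+ `|v x|) => [i|].
  by apply: (subfield_div hE) => //; [case: (Rr i)|exact: (subfieldX hE _ E_t)].
apply: (mulfI tn0); rewrite xE mulr_sumr; apply: eq_bigr => i _.
by rewrite mulrA [_ * (r i / _)]mulrC divfK.
Qed.

End LocalBasis.

(** * Property A and the degree *)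

Lemma finite_set_of_bound (T : choiceType) (A : set T) B :
  (forall m (z : 'I_m -> T), injective z -> (forall i, A (z i)) -> (m <= B)%N) ->
  finite_set A.
Proof.
move=> bnd; apply: contrapT => /(infinite_set_fset B.+1)[X XA sX].
have us : uniq (finmap.enum_fset X) by apply: finmap.fset_uniq.
case sE : (finmap.enum_fset X) us sX => [//|x0 s'] us sX.
have lts (i : 'I_B.+1) : (i < size (x0 :: s'))%N by apply: leq_trans sX.
suff: (B.+1 <= B)%N by rewrite ltnn.
apply: (bnd B.+1 (fun i => nth x0 (x0 :: s') i)) => [i j|i].
- move=> /eqP; by rewrite nth_uniq ?lts // => /eqP/val_inj.
- apply: XA; rewrite /=; have : nth x0 (x0 :: s') i \in (x0 :: s').
    by rewrite mem_nth.
  by rewrite -sE.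
Qed.

Lemma constant_field_subfield (p : nat) (K : fieldType) (iFp : {rmorphism 'F_p -> K}) :
  is_subfield (constant_field iFp).
Proof.
split; first by apply/mem_set/algebraic1.
- by move=> x y /set_mem ax /set_mem ay; apply/mem_set/algebraic_sub.
- by move=> x y /set_mem ax /set_mem ay; apply/mem_set/algebraic_div.
Qed.

Section LocalGlobal.
Variables (K Kv : fieldType) (v : K -> int) (w : Kv -> int).
Variables (iota : {rmorphism K -> Kv}).
Hypotheses (hv : is_valuation v) (hKv : is_completion v iota w).
Variables (F : fieldType) (phi : {rmorphism F -> K}).
Hypothesis finF : finite_set (range phi).
Variables (t : K) (t0 : t != 0) (vt : 0 < v t).
Variables (d : nat) (b : 'I_d -> K).
Hypotheses (b0 : forall i, val_ge v 0 (b i)) (indb : independent_mod v (range phi) t b).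
Hypothesis spanb : spanning_mod v (range phi) t b.
Variables (Gamma0 : set K).
Hypothesis finG : finite_set Gamma0.
Hypothesis hGamma : complete_representatives w (iota @` Gamma0) (iota t).

Local Notation E := (subfield_gen (range phi `|` [set t])).

Let hw : is_valuation w. Proof. by case: hKv. Qed.
Let it0 : iota t != 0. Proof. by rewrite fmorph_eq0. Qed.
Let wt : w (iota t) = v t. Proof. by case: hKv => _ ->. Qed.
Let wt0 : 0 < w (iota t). Proof. by rewrite wt. Qed.
Let phi_ge0 c : val_ge v 0 (phi c).
Proof. exact: (finite_subfield_val_ge0 hv (range_subfield phi) finF (imageT _ _)). Qed.
Local Notation tail := (shift w (iota t) (iota @` Gamma0)).

(* The tails of the expansion of z have the form (\sum_i P_i(t) * b i) / D(t)
   with D fixed and the degrees of the P_i bounded, so they repeat. *)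
Lemma rational_periodic : is_basis E b -> forall z, val_ge v 0 z ->
  exists i j, (i < j)%N /\ iter i tail (iota z) = iter j tail (iota z).
Proof.
move=> [_ spanE] z z0; have /finite_seqP[s sE] := finG.
have [D [h [D0 hD]]] := common_denominator spanE (z :: s).
set evD := (map_poly phi D).[t] in D0 hD.
have /finite_seqP[sF sFE] := finF.
have [|f fP] := @bounded_comb_finite _ _ phi t _ b h sF; first by rewrite sFE.
apply: (finite_range_collision (f := fun c => iota (f c / evD))) => n.
(* Multiplied by the common denominator, every tail lands in the finite range of [f]. *)
suff [u [nE _ /fP[c _ fc]]] : exists u, [/\ iter n tail (iota z) = iota u,
    val_ge v 0 u & bounded_comb phi t b h (evD * u)].
  by exists c => //; rewrite nE fc mulrAC divff // mul1r.
elim: n => [|n [u [nE u0 hu]]].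
  by exists z; split=> //; apply: hD; rewrite mem_head.
have iu0 : val_ge w 0 (iota u) by apply/(val_ge_iota hKv).
have [[g Gg gE] ug] := digitP hw it0 hGamma iu0.
have ug' : val_ge v (v t) (u - g).
  by apply/(val_ge_iota hKv); rewrite rmorphB gE -wt.
exists ((u - g) / t); split.
- by rewrite /= nE /shift -gE -rmorphB fmorph_div.
- by rewrite mulrC; apply/(val_geMK hv); rewrite ?invr_eq0 // valuationV // opprK add0r.
(* [D * u] and [D * g] are bounded combinations congruent modulo [t], so their difference divided by
   [t] obeys the same bound. *)
rewrite mulrA mulrBr; apply: (bounded_comb_shift hv phi_ge0 t0 vt b0 indb) => //.
  by apply: hD; rewrite inE; apply/orP; right; have : Gamma0 g := Gg; rewrite sE.
by rewrite -mulrBr; apply: val_geM0l => //; apply: horner_ge0.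
Qed.

(** Under property A, [periodic_mem] puts every integral element in the span of [Gamma0] and [b],
    and Nakayama discards [Gamma0]. Conversely, [rational_periodic] handles elements of [K], and
    periodic digits sum inside [K]. *)
Lemma property_A_basis : property_A w iota (iota @` Gamma0) (iota t) <-> is_basis E b.
Proof.
rewrite (property_A_digits hw it0 wt0 hGamma); split=> [A|basis y m y0].
  apply: (global_basis hv hKv phi_ge0 t0 vt b0 indb).
  have /finite_seqP[s sE] := finG.
  have sG g : g \in s -> Gamma0 g by rewrite sE.
  apply: (local_span_nakayama hv phi_ge0 t0 vt spanb (s := s)) => [g /sG Gg|z z0].
    apply/(val_ge_iota hKv); apply: (representatives_ge0 hGamma).
    by exists g.
  have iz0 : val_ge w 0 (iota z) by apply/(val_ge_iota hKv).
  have [i [j [ij eq]]] : exists i j, (i < j)%N /\ iter i tail (iota z) = iter j tail (iota z).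
    by apply/(A _ 0 iz0); exists z => //; rewrite expr0z mulr1.
  suff [u su /(fmorph_inj iota) <-//] : [set iota u | u in local_span v phi t b s] (iota z).
  apply: (periodic_mem hw it0 wt0 hGamma iz0 _ _ _ _ _ ij eq).
  - by exists 0; [exact: local_span0|rewrite rmorph0].
  - move=> _ _ [u su <-] [u' su' <-]; exists (u + u'); last by rewrite rmorphD.
    exact: local_spanD.
  - move=> _ [g Gg <-]; exists g => //; apply: local_span_mem => //.
    by have : Gamma0 g := Gg; rewrite sE.
  - move=> _ [u su <-]; exists (t * u); last by rewrite rmorphM mulrC.
    by apply: local_spanM => //; apply: local_subring_t.
  - move=> n _ [u su <-].
    have Rtn : local_subring v phi t (t ^+ n).
      elim: n => [|n ih]; first exact: local_subring1.
      by rewrite exprS; apply: local_subringM => //; apply: local_subring_t.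
    have [n0 Rinv] := local_subring_unit hv vt Rtn.
    exists ((1 - t * t ^+ n)^-1 * u); first exact: local_spanM.
    by rewrite rmorphM fmorphV rmorphB rmorph1 rmorphM rmorphXn -exprS mulrC.
split=> [[z _ zE]|[i [j [ij eq]]]].
  have yE : y = iota (z / t ^ m).
    by rewrite fmorph_div zE fmorphXz mulfK // expfz_neq0.
  rewrite yE in y0 *; apply: rational_periodic => //.
  exact/(val_ge_iota hKv).
have hR := range_subfield iota.
have Rpi : range iota (iota t) by exists t.
have [z _ <-] : range iota y.
  apply: (periodic_mem hw it0 wt0 hGamma y0 (subfield0 hR) (subfieldD hR) _ _ _ ij eq).
  - by move=> _ [g _ <-]; exists g.
  - by move=> u Ru; exact: (subfieldM hR Ru Rpi).
  - move=> n u Ru; apply: (subfield_div hR Ru).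
    exact: (subfieldB hR (subfield1 hR) (subfieldX hR _ Rpi)).
by exists (z * t ^ m) => //; rewrite rmorphM fmorphXz.
Qed.

(** The closure has degree [d] in any case, so equality says that [E] has degree [d], and then the
    [d] independent elements of [b] form a basis. *)
Lemma property_A_degree : property_A w iota (iota @` Gamma0) (iota t) <->
  degree E = degree (val_closure w (iota @` E)).
Proof.
have hE : is_subfield E := subfield_gen_subfield _.
have -> : degree (val_closure w (iota @` E)) = Some d.
  apply/degreeP; first by apply: (Ehat_subfield hKv phi t).
  by exists (fun i => iota (b i)); apply: (closure_basis hv hKv phi_ge0 t0 vt b0 indb spanb).
rewrite property_A_basis (degreeP _ hE); split=> [hb|hd]; first by exists b.
exact: (independent_is_basis hE hd (independent_global hv hKv phi_ge0 t0 vt b0 indb)).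
Qed.

End LocalGlobal.

Lemma property_A_iff_degree (p : nat) (K : fieldType) (iFp : {rmorphism 'F_p -> K})
    (hK : is_global_function_field iFp) (finC : finite_set (constant_field iFp))
    (v : K -> int) (hv : is_valuation v)
    (Kv : fieldType) (iota : {rmorphism K -> Kv}) (w : Kv -> int)
    (hKv : is_completion v iota w)
    (t : K) (t0 : t != 0) (vt : 0 < v t)
    (Gamma : set Kv) (hGamma : complete_representatives w Gamma (iota t))
    (ratG : Gamma `<=` range iota) :
  let Fq_pi := subfield_gen (constant_field iFp `|` [set t]) in
  property_A w iota Gamma (iota t) <->
  degree Fq_pi = degree (val_closure w (iota @` Fq_pi)).
Proof.
have hw : is_valuation w by case: hKv.
have it0 : iota t != 0 by rewrite fmorph_eq0.
have wt : w (iota t) = v t by case: hKv => _ ->.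
have wt0 : 0 < w (iota t) by rewrite wt.
have [F [phi phiE]] := subfieldP (constant_field_subfield iFp).
rewrite phiE in finC *.
have [_ [x [_ [n [beta [_ spanbeta]]]]]] := hK.
have finFp : finite_set (range iFp).
  apply/finite_seqP; exists [seq iFp a | a <- enum 'F_p].
  rewrite eqEsubset; split=> [_ [a _ <-]|_ /mapP[a _ ->]]; last by exists a.
  by apply: map_f; rewrite mem_enum.
(* The count is made over F_p(x), where finiteness of the degree is given; [b] below is taken over
   the constant field. *)
have [B bound] := residue_bound finFp spanbeta hv t0 vt.
have phi_ge0 c : val_ge v 0 (phi c).
  exact: (finite_subfield_val_ge0 hv (range_subfield phi) finC (imageT _ _)).
have range_ge0 c : range phi c -> val_ge v 0 c by move=> [a _ <-].
have [d [b [b0 indb spanb]]] := residue_basis hv (range_subfield phi) range_ge0 bound.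
pose Gamma0 := iota @^-1` Gamma.
have GammaE : Gamma = iota @` Gamma0.
  rewrite eqEsubset; split=> [g Gg|_ [g Gg <-//]].
  by have [g0 _ gE] := ratG g Gg; exists g0; rewrite // /Gamma0 /= gE.
(* Distinct representatives are incongruent, so the bound on incongruent families applies. *)
have finG : finite_set Gamma0.
  apply: (finite_set_of_bound (B := B)) => m z zinj Gz; apply: bound => [i|i j].
    by apply/(val_ge_iota hKv); apply: (representatives_ge0 hGamma); exact: (Gz i).
  move=> /(val_ge_iota hKv); rewrite rmorphB -wt => zij; apply: zinj.
  have z0 : val_ge w 0 (iota (z i)) by apply: (representatives_ge0 hGamma); exact: (Gz i).
  apply: (fmorph_inj iota).
  rewrite (digit_unique hw it0 hGamma z0 (Gz j) zij).
  by apply: (digit_unique hw it0 hGamma z0 (Gz i)); rewrite subrr; left.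
rewrite GammaE in hGamma *.
exact: (property_A_degree hv hKv finC t0 vt b0 indb spanb finG hGamma).
Qed.

Theorem theorem1p1 (p q : nat) (K : fieldType) (iFp : {rmorphism 'F_p -> K})
    (hK : is_global_function_field iFp)
    (hFq : (constant_field iFp #= `I_q)%card)
    (v : K -> int) (hv : is_valuation v) (hv0 : nontrivial_valuation v)
    (hv1 : normalized v)
    (Kv : fieldType) (iota : {rmorphism K -> Kv}) (w : Kv -> int)
    (hKv : is_completion v iota w)
    (pi : Kv) (hpi0 : pi != 0) (hpi : 0 < w pi)
    (Gamma : set Kv) (hGamma : complete_representatives w Gamma pi) :
  property_A w iota Gamma pi <->
  exists pi0 : K,
    let Fq_pi := subfield_gen (constant_field iFp `|` [set pi0]) in
    [/\ pi = iota pi0,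
        Gamma `<=` range iota
      & degree Fq_pi = degree (val_closure w (iota @` Fq_pi))].
Proof.
have hw : is_valuation w by case: hKv.
have finC : finite_set (constant_field iFp) by exists q.
have key t : pi = iota t -> Gamma `<=` range iota ->
    let Fq_pi := subfield_gen (constant_field iFp `|` [set t]) in
    property_A w iota Gamma pi <->
    degree Fq_pi = degree (val_closure w (iota @` Fq_pi)).
  move=> piE ratG; rewrite piE in hpi0 hpi hGamma *.
  have t0 : t != 0 by rewrite -(fmorph_eq0 iota).
  apply: (property_A_iff_degree hK finC hv hKv t0 _ hGamma ratG).
  by case: hKv => _ <-.
split=> [A|[t [piE ratG deg]]]; last exact/(key t piE ratG).
(* Rationality comes first: the degree condition refers to a preimage of [pi] in [K]. *)
have [[t _ piE] ratG] := property_A_rational hw hpi0 hpi hGamma A.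
by exists t; split=> //; apply/key.
Qed.
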